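(* Let $n\in\omega$ with $n\ge2$. Then the logic $\mathcal{DPCG}_n$ corresponding to the variety $\mathbb{DPCG}_n$ is defined, relative to (as an axiomatic extension of) the logic $\mathcal{DPCG}$, by the axiom $$\bigvee_{j=1}^{n}\alpha_j\ \vee\ \bigvee_{j=1}^{n-1}(\alpha_j\to\alpha_{j+1}).$$
   Context: Language: $\langle\vee,\wedge,\to,\sim,\bot,\top\rangle$ of arities $2,2,2,1,0,0$. $\alpha\to_H\beta$ abbreviates $\alpha\to(\alpha\wedge\beta)$. The logic $\mathcal{DHMSH}$ is the Hilbert-style logic with axiom schemes: (A1) $\alpha\to_H(\alpha\vee\beta)$; (A2) $\beta\to_H(\alpha\vee\beta)$; (A3) $(\alpha\to_H\gamma)\to_H[(\beta\to_H\gamma)\to_H((\alpha\vee\beta)\to_H\gamma)]$; (A4) $(\alpha\wedge\beta)\to_H\alpha$; (A5) $(\gamma\to_H\alpha)\to_H[(\gamma\to_H\beta)\to_H(\gamma\to_H(\alpha\wedge\beta))]$; (A6) $\top$; (A7) $\bot\to_H\alpha$; (A8) $((\alpha\wedge\beta)\to_H\gamma)\to_H(\alpha\to_H(\beta\to_H\gamma))$; (A9) $(\alpha\to_H(\beta\to_H\gamma))\to_H((\alpha\wedge\beta)\to_H\gamma)$; (A10) $(\alpha\to_H\beta)\to_H((\beta\to_H\alpha)\to_H((\alpha\to\gamma)\to_H(\beta\to\gamma)))$; (A11) $(\alpha\to_H\beta)\to_H((\beta\to_H\alpha)\to_H((\gamma\to\beta)\to_H(\gamma\to\alpha)))$; (A12)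 $\top\to_H{\sim}\bot$; (A13) ${\sim}\top\to_H\bot$; (A14) ${\sim}(\alpha\wedge\beta)\to_H({\sim}\alpha\vee{\sim}\beta)$; and rules (SMP): from $\phi$ and $\phi\to_H\gamma$ deduce $\gamma$; (SCP): from $\phi\to_H\gamma$ deduce ${\sim}\gamma\to_H{\sim}\phi$ (both applicable to any formulas derived from the premises). An axiomatic extension is obtained by adjoining new axiom schemes and keeping the same rules. A semi-Heyting algebra is an algebra $\langle L,\vee,\wedge,\to,0,1\rangle$ such that $\langle L,\vee,\wedge,0,1\rangle$ is a lattice with $0$ and $1$, and $x\wedge(x\to y)\approx x\wedge y$, $x\wedge(y\to z)\approx x\wedge[(x\wedge y)\to(x\wedge z)]$, $x\to x\approx1$. $\mathbb{DHMSH}$ is the variety of algebras $\langle A,\vee,\wedge,\to,{}',0,1\rangle$ such that $\langle A,\vee,\wedge,\to,0,1\rangle$ is a semi-Heyting algebra and $0'\approx1$, $1'\approx0$, $(x\wedge y)'\approx x'\vee y'$. $\mathbb{DPCH}$ (dually pseudocomplemented Heyting algebras) is the subvariety of $\mathbb{DHMSH}$ defined by $(x\vee y)''\approx x''\vee y''$, $x'''\approx x'$, $x''\le x$, $x\vee x'\approx1$ and $(x\wedge y)\to x\approx1$. A $\mathbb{DPCH}$-chain is a member of $\mathbb{DPCH}$ whose lattice reduct is a chain (so $\to$ is the Heyting implication of the chain, $1'=0$, and $x'=1$ for $x\ne1$). $\mathbb{DPCG}$ is the variety generated by all $\mathbb{DPCH}$-chains, and $\mathbb{DPCG}_n$ is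 the variety generated by the $n$-element $\mathbb{DPCH}$-chain. Formulas are interpreted with $\sim,\bot,\top$ as ${}',0,1$. The logic corresponding to a subvariety $\mathbb V$ of $\mathbb{DHMSH}$ is the unique axiomatic extension $\mathcal E$ of $\mathcal{DHMSH}$ such that $\mathbb V=\{\mathbf A\in\mathbb{DHMSH}:\mathbf A\models\delta\approx1\text{ for every theorem }\delta\text{ of }\mathcal E\}$. $\mathcal{DPCG}$ is the logic corresponding to $\mathbb{DPCG}$. *)

(* Defs.v *)
From Stdlib Require Import List FinFun.

(** * Formulas *)

(** Formulas also serve as the terms of the algebraic language, with
    [Neg], [Bot], [Top] read as ', 0, 1. *)
Inductive formula : Set :=
| Var (i : nat)
| Or (a b : formula)
| And (a b : formula)
| Imp (a b : formula)
| Neg (a : formula)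
| Bot
| Top.

Declare Scope form_scope.
Delimit Scope form_scope with form.
Bind Scope form_scope with formula.

Notation "a ∨ b" := (Or a b) (at level 50, left associativity) : form_scope.
Notation "a ∧ b" := (And a b) (at level 40, left associativity) : form_scope.
Notation "a → b" := (Imp a b) (at level 60, right associativity) : form_scope.
Notation "∼ a" := (Neg a) (at level 35, right associativity) : form_scope.
Notation "⊥" := Bot : form_scope.
Notation "⊤" := Top : form_scope.

Definition ImpH (a b : formula) : formula := (a → (a ∧ b))%form.
Notation "a →H b" := (ImpH a b) (at level 60, right associativity) : form_scope.

Fixpoint subst (s : nat -> formula) (a : formula) : formula :=
  match a with
  | Var i => s i
  | Or a b => Or (subst s a) (subst s b)
  | And a b => And (subst s a) (subst s b)
  | Imp a b => Imp (subst s a) (subst s b)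
  | Neg a => Neg (subst s a)
  | Bot => Bot
  | Top => Top
  end.

(** * The logic DHMSH and its axiomatic extensions *)

Local Open Scope form_scope.

Inductive DHMSH_axiom : formula -> Prop :=
| A1 a b : DHMSH_axiom (a →H (a ∨ b))
| A2 a b : DHMSH_axiom (b →H (a ∨ b))
| A3 a b c : DHMSH_axiom ((a →H c) →H ((b →H c) →H ((a ∨ b) →H c)))
| A4 a b : DHMSH_axiom ((a ∧ b) →H a)
| A5 a b c : DHMSH_axiom ((c →H a) →H ((c →H b) →H (c →H (a ∧ b))))
| A6 : DHMSH_axiom ⊤
| A7 a : DHMSH_axiom (⊥ →H a)
| A8 a b c : DHMSH_axiom (((a ∧ b) →H c) →H (a →H (b →H c)))
| A9 a b c : DHMSH_axiom ((a →H (b →H c)) →H ((a ∧ b) →H c))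
| A10 a b c : DHMSH_axiom ((a →H b) →H ((b →H a) →H ((a → c) →H (b → c))))
| A11 a b c : DHMSH_axiom ((a →H b) →H ((b →H a) →H ((c → b) →H (c → a))))
| A12 : DHMSH_axiom (⊤ →H ∼ ⊥)
| A13 : DHMSH_axiom (∼ ⊤ →H ⊥)
| A14 a b : DHMSH_axiom (∼ (a ∧ b) →H (∼ a ∨ ∼ b)).

(** A logic is a consequence relation between sets of formulas and formulas. *)
Definition logic : Type := (formula -> Prop) -> formula -> Prop.

Definition same_logic (L L' : logic) : Prop :=
  forall Gamma a, L Gamma a <-> L' Gamma a.

Definition theorem_of (L : logic) (a : formula) : Prop :=
  L (fun _ => False) a.

(** [extension Ax] is the axiomatic extension of DHMSH by the axiom schemes in
    [Ax]; the variables of a formula in [Ax] play the role of metavariables, so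
    that every substitution instance of it is an axiom. *)
Inductive extension (Ax : formula -> Prop) (Gamma : formula -> Prop)
  : formula -> Prop :=
| ext_base a : DHMSH_axiom a -> extension Ax Gamma a
| ext_axiom a s : Ax a -> extension Ax Gamma (subst s a)
| ext_premise a : Gamma a -> extension Ax Gamma a
| ext_SMP a b :
    extension Ax Gamma a -> extension Ax Gamma (a →H b) -> extension Ax Gamma b
| ext_SCP a b :
    extension Ax Gamma (a →H b) -> extension Ax Gamma (∼ b →H ∼ a).

Definition axiomatic_extension (L : logic) : Prop :=
  exists Ax, same_logic L (extension Ax).

Definition axiomatized_relative_to (L0 L : logic) (d : formula) : Prop :=
  forall Ax, same_logic L0 (extension Ax) ->
    same_logic L (extension (fun a => Ax a \/ a = d)).

(** * Algebras and varieties *)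

Record algebra : Type := Algebra {
  carrier :> Type;
  join : carrier -> carrier -> carrier;
  meet : carrier -> carrier -> carrier;
  imp : carrier -> carrier -> carrier;
  neg : carrier -> carrier;
  zero : carrier;
  one : carrier
}.

Arguments join {_} _ _.
Arguments meet {_} _ _.
Arguments imp {_} _ _.
Arguments neg {_} _.
Arguments zero {_}.
Arguments one {_}.

Fixpoint eval {A : algebra} (v : nat -> A) (a : formula) : A :=
  match a with
  | Var i => v i
  | Or a b => join (eval v a) (eval v b)
  | And a b => meet (eval v a) (eval v b)
  | Imp a b => imp (eval v a) (eval v b)
  | Neg a => neg (eval v a)
  | Bot => zero
  | Top => one
  end.

Definition satisfies (A : algebra) (s t : formula) : Prop :=
  forall v : nat -> A, eval v s = eval v t.

Definition is_variety (K : algebra -> Prop) : Prop :=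
  exists E : formula -> formula -> Prop,
    forall A, K A <-> (forall s t, E s t -> satisfies A s t).

Definition variety_generated_by (K : algebra -> Prop) (A : algebra) : Prop :=
  forall W, is_variety W -> (forall B, K B -> W B) -> W A.

Record bounded_lattice (A : algebra) : Prop := {
  joinC : forall x y : A, join x y = join y x;
  meetC : forall x y : A, meet x y = meet y x;
  joinA : forall x y z : A, join x (join y z) = join (join x y) z;
  meetA : forall x y z : A, meet x (meet y z) = meet (meet x y) z;
  join_meet : forall x y : A, join x (meet x y) = x;
  meet_join : forall x y : A, meet x (join x y) = x;
  join_zero : forall x : A, join x zero = x;
  meet_one : forall x : A, meet x one = x
}.

Record semi_Heyting (A : algebra) : Prop := {
  sh_lattice : bounded_lattice A;
  sh_mp : forall x y : A, meet x (imp x y) = meet x y;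
  sh_rel : forall x y z : A,
    meet x (imp y z) = meet x (imp (meet x y) (meet x z));
  sh_refl : forall x : A, imp x x = one
}.

Record DHMSH (A : algebra) : Prop := {
  dhmsh_sh : semi_Heyting A;
  neg_zero : neg zero = one :> A;
  neg_one : neg one = zero :> A;
  neg_meet : forall x y : A, neg (meet x y) = join (neg x) (neg y)
}.

Definition alg_le {A : algebra} (x y : A) : Prop := meet x y = x.

Record DPCH (A : algebra) : Prop := {
  dpch_dhmsh : DHMSH A;
  dpch_join : forall x y : A,
    neg (neg (join x y)) = join (neg (neg x)) (neg (neg y));
  dpch_neg3 : forall x : A, neg (neg (neg x)) = neg x;
  dpch_neg2 : forall x : A, alg_le (neg (neg x)) x;
  dpch_em : forall x : A, join x (neg x) = one;
  dpch_Heyting : forall x y : A, imp (meet x y) x = one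
}.

Definition DPCH_chain (A : algebra) : Prop :=
  DPCH A /\ forall x y : A, alg_le x y \/ alg_le y x.

Definition has_cardinal (A : algebra) (n : nat) : Prop :=
  exists l : list A, Listing l /\ length l = n.

Definition DPCG : algebra -> Prop := variety_generated_by DPCH_chain.

(** The [n]-element DPCH-chain is unique up to isomorphism, and a variety is
    closed under isomorphism, so the generating class below stands for it. *)
Definition DPCG_ (n : nat) : algebra -> Prop :=
  variety_generated_by (fun A => DPCH_chain A /\ has_cardinal A n).

(** * The logic corresponding to a variety *)

Definition corresponds (V : algebra -> Prop) (L : logic) : Prop :=
  axiomatic_extension L /\
  forall A, V A <->
    (DHMSH A /\ forall d, theorem_of L d -> satisfies A d Top).

Definition the_logic_of (V : algebra -> Prop) (L : logic) : Prop :=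
  corresponds V L /\ forall L', corresponds V L' -> same_logic L' L.

(** * The axiom *)

(** [big_or f m] is f 1 ∨ ... ∨ f m, for m >= 1. *)
Fixpoint big_or (f : nat -> formula) (m : nat) : formula :=
  match m with
  | 0 => ⊥
  | S k => match k with
           | 0 => f 1
           | S _ => big_or f k ∨ f m
           end
  end.

Definition chain_axiom (n : nat) : formula :=
  big_or (fun j => Var j) n ∨ big_or (fun j => Var j → Var (S j)) (n - 1).

(* Main.v *)
From Stdlib Require Import List Sorting.Sorted Arith Lia.
From Stdlib Require Import Classical ClassicalEpsilon.
From Stdlib Require Import FunctionalExtensionality PropExtensionality.
Require Import Defs.

(** The logic of a class [K] of DHMSH-algebras is the extension of DHMSH by all
    formulas identically 1 in [K].  It corresponds to the variety generated by
    [K], because in these algebras an equation [s ≈ t] says exactly that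
    [s →H t] and [t →H s] are identically 1.  Any logic corresponding to a
    variety [V] is strongly complete for [V] ([corresponds_complete]): the
    formulas modulo provable [→H]-equivalence from given premises form a member
    of [V].  So at most one logic corresponds to [V], and the claim reduces to
    an algebraic one ([DPCG_n_chain_axiom]): the members of [DPCG_ n] are
    precisely the members of [DPCG] that satisfy the chain axiom.

    In a DPCH-chain the chain axiom is refuted by [v] exactly when
    [1 > v 1 > ... > v n], so it holds in the [n]-element chain.  Conversely,
    let [s ≈ t] be valid in the [n]-element chain and let [v] be a valuation in
    an arbitrary DPCH-chain.  The elements 0, 1 and [v i], for [i] a variable
    of [s] or [t], form a subalgebra.  If all instances of the chain axiom by ⊥
    and these variables hold under [v], then this subalgebra has at most [n]
    elements; hence it is trivial or embeds in the [n]-element chain, and [s]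
    and [t] take the same value ([chain_instances_complete]).

    No representation of [DPCG]-algebras by chains is needed to transfer this to
    every [A] in [DPCG].  There are finitely many such instances [g], and in a
    chain [∼∼g] is 1 if [g] is 1, and 0 otherwise.  Hence, with [c] the
    conjunction of the formulas [∼∼g], the equation [c ∧ s ≈ c ∧ t] holds in
    all DPCH-chains, so in [A]; if [A] satisfies the chain axiom then [c] is 1
    in [A], and [s ≈ t] holds there. *)

Local Notation "x ⊑ y" := (alg_le x y) (at level 70).

(** * Order and implication in semi-Heyting algebras *)

Section Lattice.

Variable A : algebra.
Hypothesis HL : bounded_lattice A.

Lemma meet_idem (x : A) : meet x x = x.
Proof.
  rewrite <- (join_meet A HL x x) at 2. apply (meet_join A HL).
Qed.

Lemma le_refl (x : A) : x ⊑ x.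
Proof. apply meet_idem. Qed.

Lemma le_trans (x y z : A) : x ⊑ y -> y ⊑ z -> x ⊑ z.
Proof.
  unfold alg_le; intros H1 H2.
  rewrite <- H1 at 1. now rewrite <- (meetA A HL), H2.
Qed.

Lemma le_antisym (x y : A) : x ⊑ y -> y ⊑ x -> x = y.
Proof.
  unfold alg_le; intros H1 H2. now rewrite <- H1, (meetC A HL).
Qed.

Lemma meet_le_r (x y : A) : meet x y ⊑ y.
Proof. unfold alg_le. now rewrite <- (meetA A HL), meet_idem. Qed.

Lemma meet_le_l (x y : A) : meet x y ⊑ x.
Proof. rewrite (meetC A HL). apply meet_le_r. Qed.

Lemma meet_glb (x y z : A) : z ⊑ x -> z ⊑ y -> z ⊑ meet x y.
Proof. unfold alg_le; intros H1 H2. now rewrite (meetA A HL), H1, H2. Qed.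

Lemma join_le_l (x y : A) : x ⊑ join x y.
Proof. apply (meet_join A HL). Qed.

Lemma join_le_r (x y : A) : y ⊑ join x y.
Proof. rewrite (joinC A HL). apply join_le_l. Qed.

Lemma le_join (x y : A) : x ⊑ y -> join x y = y.
Proof.
  unfold alg_le; intros H.
  rewrite <- H, (meetC A HL), (joinC A HL). apply (join_meet A HL).
Qed.

Lemma join_lub (x y z : A) : x ⊑ z -> y ⊑ z -> join x y ⊑ z.
Proof.
  intros H1%le_join H2%le_join.
  rewrite <- H1, <- H2, (joinA A HL). apply join_le_l.
Qed.

Lemma zero_le (x : A) : zero ⊑ x.
Proof. rewrite <- (join_zero A HL x). apply join_le_r. Qed.

Lemma le_one (x : A) : x ⊑ one.
Proof. apply (meet_one A HL). Qed.

Lemma one_le (x : A) : one ⊑ x -> x = one.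
Proof. intros H. apply le_antisym; [apply le_one | exact H]. Qed.

End Lattice.

(** Closes goals [m ⊑ x] by projecting from meets, pairing into them and using
    hypotheses. *)
Ltac lat HL :=
  solve
    [ assumption
    | apply (le_refl _ HL)
    | apply (le_one _ HL)
    | apply (meet_glb _ HL); lat HL
    | eapply (le_trans _ HL); [apply (meet_le_l _ HL) | lat HL]
    | eapply (le_trans _ HL); [apply (meet_le_r _ HL) | lat HL] ].

(** The algebraic counterpart of the connective →H. *)
Definition impH {A : algebra} (x y : A) : A := imp x (meet x y).

(** Although → is not residuated in a semi-Heyting algebra, →H is: it is the
    Heyting implication of the lattice order. *)
Section SemiHeyting.

Variable A : algebra.
Hypothesis HS : semi_Heyting A.
Let HL : bounded_lattice A := sh_lattice A HS.

Lemma impH_residual (x y z : A) : z ⊑ impH x y <-> meet z x ⊑ y.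
Proof.
  unfold impH; split; intros H.
  - apply (le_trans _ HL) with (meet x (imp x (meet x y))); [lat HL|].
    rewrite (sh_mp A HS). lat HL.
  - unfold alg_le. rewrite (sh_rel A HS), (meetA A HL), H, (sh_refl A HS).
    apply (meet_one A HL).
Qed.

Lemma impH_one (x y : A) : impH x y = one <-> x ⊑ y.
Proof.
  split; intros H.
  - apply (le_trans _ HL) with (meet one x); [lat HL|].
    apply impH_residual. rewrite H. lat HL.
  - apply (one_le _ HL), impH_residual. lat HL.
Qed.

Lemma impH_mp (p x y : A) : p ⊑ impH x y -> p ⊑ x -> p ⊑ y.
Proof.
  intros H1%impH_residual H2. apply (le_trans _ HL) with (meet p x); lat HL.
Qed.

Lemma impH_meet_eq (x y p : A) :
  p ⊑ impH x y -> p ⊑ impH y x -> meet p x = meet p y.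
Proof.
  intros H1%impH_residual H2%impH_residual.
  apply (le_antisym _ HL); lat HL.
Qed.

(** Below [p], the implication depends on its arguments only through their
    meets with [p]. *)
Lemma imp_rel_l (p x y z : A) :
  meet p x = meet p y -> meet p (imp x z) = meet p (imp y z).
Proof.
  intros H. now rewrite (sh_rel A HS p x z), H, <- (sh_rel A HS).
Qed.

Lemma imp_rel_r (p x y z : A) :
  meet p x = meet p y -> meet p (imp z x) = meet p (imp z y).
Proof.
  intros H. now rewrite (sh_rel A HS p z x), H, <- (sh_rel A HS).
Qed.

End SemiHeyting.

(** * Soundness *)

Lemma eval_ImpH (A : algebra) (v : nat -> A) a b :
  eval v (ImpH a b) = impH (eval v a) (eval v b).
Proof. reflexivity. Qed.

Lemma eval_subst (A : algebra) (v : nat -> A) s a :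
  eval v (subst s a) = eval (fun i => eval v (s i)) a.
Proof. induction a; simpl; congruence. Qed.

Lemma subst_Var a : subst Var a = a.
Proof. induction a; simpl; congruence. Qed.

Lemma neg_antitone (A : algebra) (HD : DHMSH A) (x y : A) :
  x ⊑ y -> neg y ⊑ neg x.
Proof.
  intros H. pose proof (sh_lattice A (dhmsh_sh A HD)) as HL.
  rewrite <- H, (neg_meet A HD). apply (join_le_r _ HL).
Qed.

Lemma DHMSH_axiom_sound (A : algebra) (HD : DHMSH A) (v : nat -> A) a :
  DHMSH_axiom a -> eval v a = one.
Proof.
  pose proof (dhmsh_sh A HD) as HS. pose proof (sh_lattice A HS) as HL.
  intros []; rewrite ?eval_ImpH; try apply (impH_one A HS); simpl;
    repeat change (imp ?x (meet ?x ?y)) with (impH x y).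
  - apply (join_le_l _ HL).
  - apply (join_le_r _ HL).
  - set (x := eval v a0); set (y := eval v b); set (z := eval v c).
    do 2 apply (impH_residual _ HS).
    rewrite (meetC A HL). apply (impH_residual _ HS).
    apply (join_lub _ HL); apply (impH_residual _ HS).
    + apply (impH_mp _ HS) with x; lat HL.
    + apply (impH_mp _ HS) with y; lat HL.
  - lat HL.
  - set (x := eval v a0); set (y := eval v b); set (z := eval v c).
    do 2 apply (impH_residual _ HS). apply (meet_glb _ HL).
    + apply (impH_mp _ HS) with z; lat HL.
    + apply (impH_mp _ HS) with z; lat HL.
  - reflexivity.
  - apply (zero_le _ HL).
  - set (x := eval v a0); set (y := eval v b); set (z := eval v c).
    do 2 apply (impH_residual _ HS).
    apply (impH_mp _ HS) with (meet x y); lat HL.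
  - set (x := eval v a0); set (y := eval v b); set (z := eval v c).
    apply (impH_residual _ HS).
    apply (impH_mp _ HS) with y; [|lat HL].
    apply (impH_mp _ HS) with x; lat HL.
  - set (x := eval v a0); set (y := eval v b); set (z := eval v c).
    do 2 apply (impH_residual _ HS).
    rewrite (imp_rel_l _ HS _ x y); [lat HL|].
    apply (impH_meet_eq _ HS); lat HL.
  - set (x := eval v a0); set (y := eval v b); set (z := eval v c).
    do 2 apply (impH_residual _ HS).
    rewrite (imp_rel_r _ HS _ y x); [lat HL|].
    apply (impH_meet_eq _ HS); lat HL.
  - rewrite (neg_zero A HD). lat HL.
  - rewrite (neg_one A HD). lat HL.
  - rewrite (neg_meet A HD). lat HL.
Qed.

Lemma extension_sound (Ax Gamma : formula -> Prop) (A : algebra)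
    (v : nat -> A) a :
  DHMSH A -> (forall d, Ax d -> satisfies A d Top) ->
  (forall g, Gamma g -> eval v g = one) ->
  extension Ax Gamma a -> eval v a = one.
Proof.
  intros HD HAx HG H.
  pose proof (dhmsh_sh A HD) as HS. pose proof (sh_lattice A HS) as HL.
  induction H as [a H | a s H | a H | a b _ IHa _ IHab | a b _ IH].
  - now apply DHMSH_axiom_sound.
  - rewrite eval_subst. now apply HAx.
  - auto.
  - rewrite eval_ImpH in IHab. apply (impH_one A HS) in IHab.
    rewrite IHa in IHab. now apply (one_le _ HL).
  - rewrite eval_ImpH in IH |- *. apply (impH_one A HS). simpl.
    apply neg_antitone; [exact HD|]. now apply (impH_one A HS).
Qed.

(** * Derivations and the Lindenbaum-Tarski algebra *)

Section Hilbert.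

Variables Ax Gamma : formula -> Prop.

Local Notation "⊢ a" := (extension Ax Gamma a) (at level 75).
Local Notation "a ≼ b" := (extension Ax Gamma (ImpH a b)) (at level 70).
Local Notation "a ≃ b" := (a ≼ b /\ b ≼ a) (at level 70).

Local Ltac ax H := apply ext_base; apply H.

Lemma H_K a b : a ≼ ImpH b a.
Proof. eapply ext_SMP; [ax A4|]. ax A8. Qed.

Lemma H_weaken a b : ⊢ a -> b ≼ a.
Proof. intros H. eapply ext_SMP; [exact H | apply H_K]. Qed.

Lemma H_and_intro c a b : c ≼ a -> c ≼ b -> c ≼ And a b.
Proof.
  intros H1 H2. eapply ext_SMP; [exact H2|].
  eapply ext_SMP; [exact H1|]. ax A5.
Qed.

Lemma H_curry a b c : And a b ≼ c -> a ≼ ImpH b c.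
Proof. intros H. eapply ext_SMP; [exact H|]. ax A8. Qed.

Lemma H_uncurry a b c : a ≼ ImpH b c -> And a b ≼ c.
Proof. intros H. eapply ext_SMP; [exact H|]. ax A9. Qed.

Lemma H_and_l a b : And a b ≼ a.
Proof. ax A4. Qed.

(** Replacement of interderivable formulas on the right of →; since [c →H d] is
    [c → (c ∧ d)], it is what makes reflexivity and transitivity of →H
    derivable. *)
Lemma H_Imp_r c a b : a ≃ b -> ⊢ Imp c a -> ⊢ Imp c b.
Proof.
  intros [H1 H2] H. eapply ext_SMP; [exact H|].
  eapply ext_SMP; [exact H1|]. eapply ext_SMP; [exact H2|]. ax A11.
Qed.

Lemma H_refl a : a ≼ a.
Proof.
  (* [a →H ⊤] is [a → (a ∧ ⊤)], and [a ∧ ⊤] is interderivable with [a ∧ a]. *)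
  apply (H_Imp_r a (And a Top)).
  - split; apply H_and_intro; try apply H_and_l.
    apply H_weaken. ax A6.
  - apply H_weaken. ax A6.
Qed.

Lemma H_and_r a b : And a b ≼ b.
Proof. apply H_uncurry, H_weaken, H_refl. Qed.

Lemma H_trans a b c : a ≼ b -> b ≼ c -> a ≼ c.
Proof.
  intros H1 H2.
  (* [a →H b] is [a → (a ∧ b)]; pass from [a ∧ b] to [c ∧ a], then to
     [a ∧ c].  Each step is one of interderivable formulas. *)
  apply (H_Imp_r a (And c a)).
  - split; apply H_and_intro; apply H_and_l || apply H_and_r.
  - apply (H_Imp_r a (And a b)); [|exact H1].
    split; apply H_and_intro.
    + apply H_uncurry, H_weaken, H2.
    + apply H_and_l.
    + apply H_and_r.
    + apply H_uncurry, H_weaken, H1.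
Qed.

Lemma H_or_l a b : a ≼ Or a b.
Proof. ax A1. Qed.

Lemma H_or_r a b : b ≼ Or a b.
Proof. ax A2. Qed.

Lemma H_or_elim a b c : a ≼ c -> b ≼ c -> Or a b ≼ c.
Proof.
  intros H1 H2. eapply ext_SMP; [exact H2|].
  eapply ext_SMP; [exact H1|]. ax A3.
Qed.

Lemma H_bot a : Bot ≼ a.
Proof. ax A7. Qed.

Lemma H_top a : a ≼ Top.
Proof. apply H_weaken. ax A6. Qed.

Lemma H_mp p a b : p ≼ ImpH a b -> p ≼ a -> p ≼ b.
Proof.
  intros H1%H_uncurry H2. apply H_trans with (And p a); [|exact H1].
  apply H_and_intro; [apply H_refl | exact H2].
Qed.

Lemma H_Imp_rel_l p a b c :
  p ≼ ImpH a b -> p ≼ ImpH b a -> p ≼ Imp a c -> p ≼ Imp b c.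
Proof.
  intros H1 H2 H3. eapply H_mp; [|exact H3].
  eapply H_mp; [|exact H2]. eapply H_mp; [|exact H1].
  apply H_weaken. ax A10.
Qed.

Lemma H_Imp_rel_r p a b c :
  p ≼ ImpH a b -> p ≼ ImpH b a -> p ≼ Imp c a -> p ≼ Imp c b.
Proof.
  intros H1 H2 H3. eapply H_mp; [|exact H3].
  eapply H_mp; [|exact H1]. eapply H_mp; [|exact H2].
  apply H_weaken. ax A11.
Qed.

Lemma H_neg a b : a ≼ b -> Neg b ≼ Neg a.
Proof. apply ext_SCP. Qed.

(** Closes goals [m ≼ x] by the lattice rules and currying. *)
Local Ltac hil :=
  solve
    [ assumption
    | apply H_refl
    | apply H_top
    | apply H_bot
    | apply H_and_intro; hil
    | apply H_or_elim; hil
    | apply H_curry; hil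
    | eapply H_trans; [apply H_and_l | hil]
    | eapply H_trans; [apply H_and_r | hil]
    | eapply H_trans; [ | apply H_or_l ]; hil
    | eapply H_trans; [ | apply H_or_r ]; hil ].

Lemma H_Imp_congr a a' b b' : a ≃ a' -> b ≃ b' -> Imp a b ≼ Imp a' b'.
Proof.
  intros [] []. apply H_Imp_rel_l with a; [now apply H_weaken..|].
  apply H_Imp_rel_r with b; [now apply H_weaken..|].
  apply H_refl.
Qed.

Lemma H_sh_mp a b : And a (Imp a b) ≃ And a b.
Proof.
  split; apply H_and_intro; try hil.
  - apply H_mp with a; [|hil].
    apply (H_Imp_rel_r _ b); hil.
  - apply (H_Imp_rel_r _ (And a b)); hil.
Qed.

Lemma H_sh_rel a b c :
  And a (Imp b c) ≃ And a (Imp (And a b) (And a c)).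
Proof.
  split; (apply H_and_intro; [hil|]).
  - apply H_Imp_rel_l with b; try hil.
    apply H_Imp_rel_r with c; hil.
  - apply H_Imp_rel_l with (And a b); try hil.
    apply H_Imp_rel_r with (And a c); hil.
Qed.

Lemma H_Imp_refl a : Imp a a ≃ Top.
Proof.
  split; [hil|]. apply H_weaken.
  apply (H_Imp_r a (And a a)); [split; hil|]. apply H_refl.
Qed.

Lemma H_equiv_Top a : a ≃ Top <-> ⊢ a.
Proof.
  split.
  - intros [_ H]. eapply ext_SMP; [|exact H]. ax A6.
  - intros H. split; [apply H_top | now apply H_weaken].
Qed.

(** Interderivability, the congruence by which formulas are identified. *)
Definition hequiv (a b : formula) : Prop := a ≃ b.

(** A canonical representative of the class of [a] under interderivability. *)
Definition rep (a : formula) : formula :=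
  epsilon (inhabits Top) (hequiv a).

Lemma rep_equiv a : hequiv a (rep a).
Proof.
  unfold rep. apply epsilon_spec. exists a. split; apply H_refl.
Qed.

Lemma rep_eq a b : hequiv a b -> rep a = rep b.
Proof.
  intros [H1 H2]. unfold rep. f_equal.
  apply functional_extensionality; intros c.
  apply propositional_extensionality.
  split; intros [H3 H4]; split; eapply H_trans; eassumption.
Qed.

Lemma rep_idem a : rep (rep a) = rep a.
Proof. symmetry. apply rep_eq, rep_equiv. Qed.

(** The quotient of the formulas by interderivability, realised as the set of
    canonical representatives. *)
Definition quot : Type := {a : formula | rep a = a}.

(** The class of a formula. *)
Definition cls (a : formula) : quot := exist _ (rep a) (rep_idem a).

Lemma cls_eq a b : cls a = cls b <-> hequiv a b.
Proof.
  split; intros H.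
  - injection H as H. destruct (rep_equiv a) as [H1 H2].
    destruct (rep_equiv b) as [H3 H4]. rewrite H in H1, H2.
    split; eapply H_trans; eassumption.
  - apply eq_sig_hprop; [intros; apply proof_irrelevance|].
    now apply rep_eq.
Qed.

Lemma cls_repr (x : quot) : cls (proj1_sig x) = x.
Proof.
  apply eq_sig_hprop; [intros; apply proof_irrelevance|].
  apply (proj2_sig x).
Qed.

(** The Lindenbaum-Tarski algebra of the theory with axioms [Ax] and premises
    [Gamma]. *)
Definition lindenbaum : algebra :=
  {| carrier := quot;
     join x y := cls (Or (proj1_sig x) (proj1_sig y));
     meet x y := cls (And (proj1_sig x) (proj1_sig y));
     imp x y := cls (Imp (proj1_sig x) (proj1_sig y));
     neg x := cls (Neg (proj1_sig x));
     zero := cls Bot;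
     one := cls Top |}.

Lemma lind_join a b : join (cls a : lindenbaum) (cls b) = cls (Or a b).
Proof.
  apply cls_eq. destruct (rep_equiv a), (rep_equiv b). split; hil.
Qed.

Lemma lind_meet a b : meet (cls a : lindenbaum) (cls b) = cls (And a b).
Proof.
  apply cls_eq. destruct (rep_equiv a), (rep_equiv b). split; hil.
Qed.

Lemma lind_imp a b : imp (cls a : lindenbaum) (cls b) = cls (Imp a b).
Proof.
  apply cls_eq. destruct (rep_equiv a), (rep_equiv b).
  split; apply H_Imp_congr; split; assumption.
Qed.

Lemma lind_neg a : neg (cls a : lindenbaum) = cls (Neg a).
Proof.
  apply cls_eq. destruct (rep_equiv a). split; now apply H_neg.
Qed.

Lemma lind_surj (x : lindenbaum) : exists a, x = cls a.
Proof. exists (proj1_sig x). symmetry. apply cls_repr. Qed.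

Lemma eval_lindenbaum (s : nat -> formula) a :
  eval (fun i => cls (s i) : lindenbaum) a = cls (subst s a).
Proof.
  induction a as [i | a IHa b IHb | a IHa b IHb | a IHa b IHb | a IHa | |];
    simpl eval; rewrite ?IHa, ?IHb;
    solve [apply lind_join | apply lind_meet | apply lind_imp
          | apply lind_neg | reflexivity].
Qed.

(** Reduces an equation of the Lindenbaum algebra to interderivability of two
    formulas. *)
Local Ltac lind :=
  repeat match goal with
    | x : carrier lindenbaum |- _ =>
        let a := fresh "a" in destruct (lind_surj x) as [a ->]
    end;
  change (@zero lindenbaum) with (cls Bot);
  change (@one lindenbaum) with (cls Top);
  repeat rewrite ?lind_join, ?lind_meet, ?lind_imp, ?lind_neg;
  apply cls_eq.

Lemma lindenbaum_DHMSH : DHMSH lindenbaum.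
Proof.
  split; [split; [split|..]|..]; intros; lind;
    try solve [split; hil].
  - apply H_sh_mp.
  - apply H_sh_rel.
  - apply H_Imp_refl.
  - split; [hil | ax A12].
  - split; [ax A13 | hil].
  - split; [ax A14|]. apply H_or_elim; apply H_neg; hil.
Qed.

Lemma lindenbaum_one a : cls a = @one lindenbaum <-> ⊢ a.
Proof. rewrite <- H_equiv_Top. apply cls_eq. Qed.

End Hilbert.

(** * Varieties and the logics corresponding to them *)

Lemma subst_subst s s' a :
  subst s (subst s' a) = subst (fun i => subst s (s' i)) a.
Proof. induction a; simpl; congruence. Qed.

Lemma extension_axiom (Ax Gamma : formula -> Prop) a :
  Ax a -> extension Ax Gamma a.
Proof. intros H. rewrite <- (subst_Var a). now apply ext_axiom. Qed.

Lemma extension_mono (Ax Ax' Gamma Gamma' : formula -> Prop) a :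
  (forall d, Ax d -> Ax' d) -> (forall d, Gamma d -> Gamma' d) ->
  extension Ax Gamma a -> extension Ax' Gamma' a.
Proof.
  intros HAx HG H.
  induction H as [a H | a s H | a H | a b _ IHa _ IHab | a b _ IH].
  - now apply ext_base.
  - now apply ext_axiom, HAx.
  - now apply ext_premise, HG.
  - exact (ext_SMP _ _ _ _ IHa IHab).
  - now apply ext_SCP.
Qed.

Lemma theorem_subst (Ax : formula -> Prop) s a :
  theorem_of (extension Ax) a -> theorem_of (extension Ax) (subst s a).
Proof.
  unfold theorem_of. intros H.
  induction H as [a H | a s' H | a [] | a b _ IHa _ IHab | a b _ IH].
  - apply ext_base. destruct H; constructor.
  - rewrite subst_subst. now apply ext_axiom.
  - exact (ext_SMP _ _ _ _ IHa IHab).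
  - exact (ext_SCP _ _ _ _ IH).
Qed.

(** The equations valid in [K] axiomatise the variety that [K] generates. *)
Lemma variety_generated_by_equations (K : algebra -> Prop) (A : algebra) :
  variety_generated_by K A <->
  forall s t, (forall B, K B -> satisfies B s t) -> satisfies A s t.
Proof.
  split.
  - intros H.
    apply (H (fun A => forall s t,
      (forall B, K B -> satisfies B s t) -> satisfies A s t)); [|auto].
    exists (fun s t => forall B, K B -> satisfies B s t). intros B. reflexivity.
  - intros H W [E HE] HW. apply HE. intros s t Hst. apply H.
    intros B HB. exact (proj1 (HE B) (HW B HB) s t Hst).
Qed.

Lemma variety_generated_by_mono (K K' : algebra -> Prop) (A : algebra) :
  (forall B, K B -> K' B) ->
  variety_generated_by K A -> variety_generated_by K' A.
Proof. intros HK H W HW HKW. apply H; auto. Qed.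

Lemma DHMSH_of_equations (A : algebra) :
  (forall s t, (forall B, DHMSH B -> satisfies B s t) -> satisfies A s t) ->
  DHMSH A.
Proof.
  intros H.
  set (val := fun (x y z : A) i => match i with 0 => x | 1 => y | _ => z end).
  assert (HB : forall B, DHMSH B -> bounded_lattice B)
    by (intros B HB; apply HB).
  assert (HS : forall B, DHMSH B -> semi_Heyting B)
    by (intros B HBB; apply HBB).
  pose (X := Var 0). pose (Y := Var 1). pose (Z := Var 2).
  assert (E : forall s t, (forall B, DHMSH B -> satisfies B s t) ->
    forall x y z : A, eval (val x y z) s = eval (val x y z) t)
    by (intros s t Hst x y z; now apply H).
  (* Each law is an equation in [X], [Y], [Z]; its validity in DHMSH-algebras,
     the argument [p], is left to prove. *)
  split; [split; [split|..]|..].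
  - intros x y. apply (fun p => E (Or X Y) (Or Y X) p x y y).
    intros B HBB v. now apply joinC, HB.
  - intros x y. apply (fun p => E (And X Y) (And Y X) p x y y).
    intros B HBB v. now apply meetC, HB.
  - intros x y z. apply (fun p => E (Or X (Or Y Z)) (Or (Or X Y) Z) p x y z).
    intros B HBB v. now apply joinA, HB.
  - intros x y z.
    apply (fun p => E (And X (And Y Z)) (And (And X Y) Z) p x y z).
    intros B HBB v. now apply meetA, HB.
  - intros x y. apply (fun p => E (Or X (And X Y)) X p x y y).
    intros B HBB v. now apply join_meet, HB.
  - intros x y. apply (fun p => E (And X (Or X Y)) X p x y y).
    intros B HBB v. now apply meet_join, HB.
  - intros x. apply (fun p => E (Or X Bot) X p x x x).
    intros B HBB v. now apply join_zero, HB.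
  - intros x. apply (fun p => E (And X Top) X p x x x).
    intros B HBB v. now apply meet_one, HB.
  - intros x y. apply (fun p => E (And X (Imp X Y)) (And X Y) p x y y).
    intros B HBB v. now apply sh_mp, HS.
  - intros x y z.
    apply (fun p =>
      E (And X (Imp Y Z)) (And X (Imp (And X Y) (And X Z))) p x y z).
    intros B HBB v. now apply sh_rel, HS.
  - intros x. apply (fun p => E (Imp X X) Top p x x x).
    intros B HBB v. now apply sh_refl, HS.
  - apply (fun p => E (Neg Bot) Top p one one one).
    intros B HBB v. now apply neg_zero.
  - apply (fun p => E (Neg Top) Bot p one one one).
    intros B HBB v. now apply neg_one.
  - intros x y. apply (fun p => E (Neg (And X Y)) (Or (Neg X) (Neg Y)) p x y y).
    intros B HBB v. now apply neg_meet.
Qed.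

Lemma variety_generated_by_DHMSH (K : algebra -> Prop) (A : algebra) :
  (forall B, K B -> DHMSH B) -> variety_generated_by K A -> DHMSH A.
Proof.
  intros HK HA. apply DHMSH_of_equations. intros s t Hst.
  apply (proj1 (variety_generated_by_equations K A) HA). auto.
Qed.

Lemma satisfies_ImpH (A : algebra) (HD : DHMSH A) s t :
  satisfies A s t <->
  satisfies A (ImpH s t) Top /\ satisfies A (ImpH t s) Top.
Proof.
  pose proof (dhmsh_sh A HD) as HS. pose proof (sh_lattice A HS) as HL.
  split.
  - intros H. split; intros v; rewrite eval_ImpH, H; simpl;
      apply (impH_one _ HS), (le_refl _ HL).
  - intros [H1 H2] v. apply (le_antisym _ HL).
    + apply (impH_one _ HS). exact (H1 v).
    + apply (impH_one _ HS). exact (H2 v).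
Qed.

(** Strong completeness: the consequences of [Gamma] in a logic corresponding
    to [V] are the formulas equal to 1 wherever, in a member of [V], all of
    [Gamma] is. *)
Lemma corresponds_complete V L Gamma a :
  corresponds V L ->
  (L Gamma a <->
   forall (A : algebra) (v : nat -> A), V A ->
     (forall g, Gamma g -> eval v g = one) -> eval v a = one).
Proof.
  intros [[Ax HAx] HV]. rewrite (HAx Gamma a). split.
  - intros Ha A v HA HG. apply HV in HA. destruct HA as [HD HA].
    apply (extension_sound Ax Gamma); auto.
    intros d Hd. apply HA, HAx.
    now apply extension_axiom.
  - intros H.
    set (v := fun i => cls Ax Gamma (Var i) : lindenbaum Ax Gamma).
    assert (Hv : forall b, eval v b = cls Ax Gamma b).
    { intros b. unfold v. now rewrite eval_lindenbaum, subst_Var. }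
    (* In the Lindenbaum algebra of [Ax] and [Gamma], the canonical valuation
       [v] sends to 1 exactly the formulas derivable from [Gamma]. *)
    apply lindenbaum_one. rewrite <- Hv.
    apply (H (lindenbaum Ax Gamma) v).
    + apply HV. split; [apply lindenbaum_DHMSH|].
      intros d Hd w. simpl.
      replace w with (fun i => cls Ax Gamma (proj1_sig (w i))
                               : lindenbaum Ax Gamma)
        by (apply functional_extensionality; intros i; apply cls_repr).
      rewrite eval_lindenbaum. apply lindenbaum_one.
      apply extension_mono with Ax (fun _ => False); [auto | intros ? [] |].
      apply theorem_subst. now apply HAx.
    + intros g Hg. rewrite Hv. apply lindenbaum_one. now apply ext_premise.
Qed.

Lemma corresponds_unique V L L' :
  corresponds V L -> corresponds V L' -> same_logic L' L.
Proof.
  intros H H' Gamma a.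
  now rewrite (corresponds_complete V L Gamma a H),
    (corresponds_complete V L' Gamma a H').
Qed.

(** The logic of the formulas identically 1 in a class [K]. *)
Definition logic_of_class (K : algebra -> Prop) : logic :=
  extension (fun d => forall B, K B -> satisfies B d Top).

Lemma logic_of_class_corresponds (K : algebra -> Prop) :
  (forall B, K B -> DHMSH B) ->
  corresponds (variety_generated_by K) (logic_of_class K).
Proof.
  intros HK. split.
  { exists (fun d => forall B, K B -> satisfies B d Top).
    intros Gamma a. reflexivity. }
  intros A. split.
  - intros HA.
    assert (HD : DHMSH A) by now apply variety_generated_by_DHMSH with K.
    split; [exact HD|]. intros d Hd v.
    apply (extension_sound _ _ A v d HD) with (3 := Hd); [|intros ? []].
    intros e He. now apply (proj1 (variety_generated_by_equations K A) HA).
  - intros [HD HA]. apply variety_generated_by_equations. intros s t Hst.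
    apply (satisfies_ImpH A HD); split; apply HA;
      apply extension_axiom; intros B HB;
      apply (proj1 (satisfies_ImpH B (HK B HB) s t) (Hst B HB)).
Qed.

Lemma the_logic_of_intro V L : corresponds V L -> the_logic_of V L.
Proof.
  intros H. split; [exact H|]. intros L'. now apply corresponds_unique.
Qed.

(** * DPCH-chains and the chain axiom *)

Section Chain.

Variable C : algebra.
Hypothesis HC : DPCH_chain C.
Let HD : DHMSH C := dpch_dhmsh C (proj1 HC).
Let HS : semi_Heyting C := dhmsh_sh C HD.
Let HL : bounded_lattice C := sh_lattice C HS.

(** The strict order of the chain. *)
Definition alg_lt (x y : C) : Prop := x ⊑ y /\ x <> y.

Lemma chain_nle (x y : C) : ~ x ⊑ y <-> alg_lt y x.
Proof.
  split.
  - intros H. destruct (proj2 HC x y) as [H'|H']; [contradiction|].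
    split; [exact H'|]. intros ->. now apply H, (le_refl _ HL).
  - intros [H1 H2] H. now apply H2, (le_antisym _ HL).
Qed.

Lemma chain_join (x y : C) : x ⊑ y /\ join x y = y \/ y ⊑ x /\ join x y = x.
Proof.
  destruct (proj2 HC x y) as [H|H]; [left|right]; (split; [exact H|]).
  - now apply (le_join _ HL).
  - rewrite (joinC _ HL). now apply (le_join _ HL).
Qed.

Lemma chain_join_one (x y : C) : join x y = one <-> x = one \/ y = one.
Proof.
  split.
  - intros H. destruct (chain_join x y) as [[_ E]|[_ E]]; rewrite H in E; auto.
  - intros [-> | ->]; apply (one_le _ HL);
      apply (join_le_l _ HL) || apply (join_le_r _ HL).
Qed.

Lemma chain_imp_one (x y : C) : imp x y = one <-> x ⊑ y.
Proof.
  split; intros H.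
  - apply (le_trans _ HL) with (meet x (imp x y)).
    + rewrite H. lat HL.
    + rewrite (sh_mp _ HS). lat HL.
  - unfold alg_le in H. rewrite <- H, (meetC _ HL).
    apply (dpch_Heyting _ (proj1 HC)).
Qed.

Lemma chain_imp_gt (x y : C) : alg_lt y x -> imp x y = y.
Proof.
  intros H. assert (E : meet x (imp x y) = y).
  { rewrite (sh_mp _ HS), (meetC _ HL). apply H. }
  destruct (proj2 HC x (imp x y)) as [H'|H'].
  - rewrite H' in E. destruct H. congruence.
  - rewrite (meetC _ HL), H' in E. exact E.
Qed.

Lemma chain_neg (x : C) : x <> one -> neg x = one.
Proof.
  intros H. pose proof (dpch_em _ (proj1 HC) x) as E.
  apply chain_join_one in E. now destruct E.
Qed.

Lemma chain_neg_neg (x : C) : x <> one -> neg (neg x) = zero.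
Proof. intros H. rewrite (chain_neg x H). apply (neg_one _ HD). Qed.

(** For [m = 0] this fails in the degenerate chain with [0 = 1], where the empty
    disjunction ⊥ is 1. *)
Lemma eval_big_or_one (v : nat -> C) f m : 1 <= m ->
  (eval v (big_or f m) = one <-> exists j, 1 <= j <= m /\ eval v (f j) = one).
Proof.
  induction m as [|m IH]; [lia|]. intros _. destruct m as [|m].
  - simpl. split.
    + intros H. exists 1. auto.
    + intros (j & Hj & H). replace j with 1 in H by lia. exact H.
  - change (eval v (big_or f (S (S m)))) with
      (join (eval v (big_or f (S m))) (eval v (f (S (S m))))).
    rewrite chain_join_one, IH by lia. split.
    + intros [(j & Hj & H)|H].
      * exists j. split; [lia | exact H].
      * exists (S (S m)). split; [lia | exact H].
    + intros (j & Hj & H). destruct (Nat.eq_dec j (S (S m))) as [->|].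
      * now right.
      * left. exists j. split; [lia | exact H].
Qed.

Lemma chain_axiom_one (v : nat -> C) n : 2 <= n ->
  (eval v (chain_axiom n) = one <->
   (exists j, 1 <= j <= n /\ v j = one) \/
   (exists j, 1 <= j <= n - 1 /\ v j ⊑ v (S j))).
Proof.
  intros Hn. unfold chain_axiom. simpl eval.
  rewrite chain_join_one, !eval_big_or_one by lia. simpl eval.
  now setoid_rewrite chain_imp_one.
Qed.

(** A refuting valuation gives [n + 1] elements [1 > v 1 > ... > v n], too many
    for the chain. *)
Lemma chain_axiom_valid n : 2 <= n -> has_cardinal C n ->
  satisfies C (chain_axiom n) Top.
Proof.
  intros Hn (l & [_ Hfull] & Hl) v. change (eval v (chain_axiom n) = one).
  apply NNPP. intros H. rewrite chain_axiom_one in H by exact Hn.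
  set (w := fun j => match j with 0 => one | S _ => v j end).
  assert (Hstep : forall j, j < n -> alg_lt (w (S j)) (w j)).
  { intros [|j] Hj; simpl.
    - split; [apply (le_one _ HL)|]. intros E. apply H. left.
      exists 1. split; [lia | exact E].
    - apply chain_nle. intros E. apply H. right.
      exists (S j). split; [lia | exact E]. }
  assert (Hw : forall i k, i + S k <= n -> alg_lt (w (i + S k)) (w i)).
  { intros i. induction k as [|k IH]; intros Hk.
    - rewrite Nat.add_1_r. apply Hstep. lia.
    - rewrite Nat.add_succ_r. destruct IH as [H1 H2]; [lia|].
      destruct (Hstep (i + S k)) as [H3 H4]; [lia|]. split.
      + now apply (le_trans _ HL) with (w (i + S k)).
      + intros E. rewrite E in H3. now apply H2, (le_antisym _ HL). }
  assert (Hnd : NoDup (map w (seq 0 (S n)))).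
  { apply NoDup_map_NoDup_ForallPairs; [|apply seq_NoDup].
    intros i k Hi%in_seq Hk%in_seq E.
    destruct (lt_eq_lt_dec i k) as [[Hik|Hik]|Hik]; [|exact Hik|]; exfalso.
    - destruct (Hw i (k - i - 1)) as [_ H']; [lia|].
      replace (i + S (k - i - 1)) with k in H' by lia. auto.
    - destruct (Hw k (i - k - 1)) as [_ H']; [lia|].
      replace (k + S (i - k - 1)) with i in H' by lia. auto. }
  apply NoDup_incl_length with (l' := l) in Hnd.
  - rewrite length_map, length_seq in Hnd. lia.
  - intros x _. apply Hfull.
Qed.

(** The order by which lists are sorted, largest element first. *)
Let desc (x y : C) : Prop := alg_lt y x.

Lemma insert_sorted (a : C) d : StronglySorted desc d -> ~ In a d ->
  exists d', StronglySorted desc d' /\ forall x, In x d' <-> x = a \/ In x d.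
Proof.
  induction d as [|b d IH]; intros Hd Ha.
  - exists (a :: nil). split.
    + constructor; constructor.
    + simpl. intuition congruence.
  - apply StronglySorted_inv in Hd. destruct Hd as [Hd Hb].
    rewrite Forall_forall in Hb.
    destruct (classic (a ⊑ b)) as [Hab|Hab].
    + destruct IH as (d' & Hd' & E); [exact Hd | simpl in Ha; tauto|].
      exists (b :: d'). split.
      * constructor; [exact Hd'|]. apply Forall_forall. intros x Hx.
        apply E in Hx. destruct Hx as [-> | Hx]; [|auto].
        split; [exact Hab|]. intros ->. simpl in Ha; tauto.
      * intros x. simpl. rewrite E. tauto.
    + exists (a :: b :: d). split; [|simpl; intuition congruence].
      apply chain_nle in Hab.
      constructor; [constructor; [exact Hd | now apply Forall_forall]|].
      apply Forall_forall. intros x [<- | Hx]; [exact Hab|].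
      destruct (Hb x Hx) as [H1 H2], Hab as [H3 H4]. split.
      * now apply (le_trans _ HL) with b.
      * intros ->. now apply H4, (le_antisym _ HL).
Qed.

Lemma descending_enumeration (l : list C) :
  exists d, StronglySorted desc d /\ forall x, In x d <-> In x l /\ x <> one.
Proof.
  induction l as [|a l (d & Hd & E)].
  - exists nil. split; [constructor | simpl; tauto].
  - destruct (classic (a = one)) as [Ha|Ha];
      [|destruct (classic (In a d)) as [Hin|Hin]].
    + exists d. split; [exact Hd|]. intros x. rewrite E. simpl.
      intuition congruence.
    + exists d. split; [exact Hd|]. intros x. rewrite E. simpl.
      split; [tauto|]. intros [[<- | Hx] Hx1]; [|tauto].
      now apply E in Hin.
    + destruct (insert_sorted a d Hd Hin) as (d' & Hd' & E').
      exists d'. split; [exact Hd'|]. intros x. rewrite E', E. simpl.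
      intuition congruence.
Qed.

Lemma sorted_nth_succ d i z : StronglySorted desc d -> S i < length d ->
  desc (nth i d z) (nth (S i) d z).
Proof.
  intros Hd. revert i. induction Hd as [|a d Hd IH Ha]; simpl; [lia|].
  intros [|i] Hi.
  - rewrite Forall_forall in Ha. apply Ha, nth_In. lia.
  - apply (IH i). lia.
Qed.

End Chain.

(** * The finite DPCH-chain *)

Section FiniteChain.

Variable n : nat.
Hypothesis Hn : 2 <= n.

Let T : Type := {i : nat | i < n}.

Lemma fin_bot_lt : 0 < n.
Proof. lia. Qed.

Lemma fin_top_lt : n - 1 < n.
Proof. lia. Qed.

Let bot : T := exist _ 0 fin_bot_lt.
Let top : T := exist _ (n - 1) fin_top_lt.

(** The DPCH-chain on {0 < 1 < ... < n - 1}. *)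
Definition fin_chain : algebra :=
  {| carrier := T;
     join x y := if proj1_sig x <=? proj1_sig y then y else x;
     meet x y := if proj1_sig x <=? proj1_sig y then x else y;
     imp x y := if proj1_sig x <=? proj1_sig y then top else y;
     neg x := if proj1_sig x =? n - 1 then bot else top;
     zero := bot;
     one := top |}.

Lemma fin_eq (x y : T) : proj1_sig x = proj1_sig y -> x = y.
Proof. apply eq_sig_hprop. intros. apply proof_irrelevance. Qed.

(** Succeeds on terms without a pending case distinction, so that [fin] analyses
    inner comparisons first. *)
Local Ltac atomic i :=
  match i with context [if _ then _ else _] => fail 1 | _ => idtac end.

Local Ltac fin :=
  intros; apply fin_eq;
  repeat match goal with x : carrier fin_chain |- _ =>
    let i := fresh "i" in let H := fresh "H" in destruct x as [i H] end;
  cbn -[Nat.eqb Nat.leb Nat.sub];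
  repeat (match goal with
    | |- context [?i <=? ?j] => atomic i; atomic j; destruct (Nat.leb_spec i j)
    | |- context [?i =? ?j] => atomic i; atomic j; destruct (Nat.eqb_spec i j)
    end; cbn -[Nat.eqb Nat.leb Nat.sub]);
  try lia.

Lemma fin_chain_DPCH_chain : DPCH_chain fin_chain.
Proof.
  split; [split; [split; [split; [split|..]|..]|..]|]; unfold alg_le;
    try solve [fin].
  intros [i Hi] [j Hj]. destruct (le_ge_dec i j); [left | right]; fin.
Qed.

Lemma fin_chain_cardinal : has_cardinal fin_chain n.
Proof.
  set (inj := fun i => match lt_dec i n with
                       | left H => exist _ i H : fin_chain
                       | right _ => bot
                       end).
  assert (Hinj : forall i, i < n -> proj1_sig (inj i) = i).
  { intros i Hi. unfold inj. destruct (lt_dec i n); [reflexivity | lia]. }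
  exists (map inj (seq 0 n)). split; [split|].
  - apply NoDup_map_NoDup_ForallPairs; [|apply seq_NoDup].
    intros i k Hi%in_seq Hk%in_seq E.
    rewrite <- (Hinj i), <- (Hinj k) by lia. now rewrite E.
  - intros x. apply in_map_iff. exists (proj1_sig x).
    destruct x as [i Hi]. simpl. split.
    + apply fin_eq. simpl. now apply Hinj.
    + apply in_seq. lia.
  - now rewrite length_map, length_seq.
Qed.

End FiniteChain.

(** * Embedding a finite part of a chain *)

Lemma filter_length_lt {T : Type} (p q : T -> bool) (l : list T) x :
  (forall y, p y = true -> q y = true) ->
  In x l -> p x = false -> q x = true ->
  length (filter p l) < length (filter q l).
Proof.
  intros Hpq.
  assert (Hle : forall k, length (filter p k) <= length (filter q k)).
  { intros k. induction k as [|y k IH]; simpl; [lia|].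
    destruct (p y) eqn:Ep; [rewrite (Hpq y Ep); simpl; lia|].
    destruct (q y); simpl; lia. }
  intros Hin Hp Hq. induction l as [|y l IH]; [destruct Hin|].
  simpl. destruct Hin as [-> | Hin].
  - rewrite Hp, Hq. simpl. specialize (Hle l). lia.
  - specialize (IH Hin). destruct (p y) eqn:Ep.
    + rewrite (Hpq y Ep). simpl. lia.
    + destruct (q y); simpl; lia.
Qed.

(** The variables of a formula, with repetitions. *)
Fixpoint vars (a : formula) : list nat :=
  match a with
  | Var i => i :: nil
  | Or a b | And a b | Imp a b => vars a ++ vars b
  | Neg a => vars a
  | Bot | Top => nil
  end.

(** Here [d] lists, besides 0, elements of a nontrivial chain [C]; it is to have
    at most [n - 1] members, which leaves room for 1. *)
Section Rank.

Variables (C : algebra) (n : nat) (d : list C).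
Hypotheses (HC : DPCH_chain C) (Hn : 2 <= n).
Hypotheses (Hnt : zero <> one :> C).
Hypothesis Hzero : In zero d.
Hypothesis Hlen : length d <= n - 1.

Let HD : DHMSH C := dpch_dhmsh C (proj1 HC).
Let HS : semi_Heyting C := dhmsh_sh C HD.
Let HL : bounded_lattice C := sh_lattice C HS.

Let below (x y : C) : bool :=
  if excluded_middle_informative (alg_lt C y x) then true else false.

Lemma below_spec x y : below x y = true <-> alg_lt C y x.
Proof.
  unfold below.
  destruct (excluded_middle_informative _); intuition discriminate.
Qed.

(** The number of members of [d] strictly below [x], except that 1 goes to the
    top of the [n]-element chain. *)
Definition rank (x : C) : nat :=
  if excluded_middle_informative (x = one) then n - 1
  else length (filter (below x) d).

Lemma rank_lt_n x : rank x < n.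
Proof.
  unfold rank. destruct (excluded_middle_informative _); [lia|].
  pose proof (filter_length_le (below x) d). lia.
Qed.

Definition to_fin (x : C) : fin_chain n Hn := exist _ (rank x) (rank_lt_n x).

(** The members of [d] and 1, the domain on which [rank] is an embedding. *)
Definition listed (x : C) : Prop := In x d \/ x = one.

Lemma rank_one : rank one = n - 1.
Proof. unfold rank. now destruct (excluded_middle_informative _). Qed.

Lemma rank_lt x y : listed x -> listed y -> alg_lt C x y -> rank x < rank y.
Proof.
  intros Hx Hy Hxy.
  assert (Hx1 : x <> one).
  { intros ->. destruct Hxy as [H1 H2]. apply H2. symmetry.
    now apply (one_le _ HL). }
  destruct Hx as [Hx | ?]; [|contradiction].
  assert (Hlt : length (filter (below x) d) < length (filter (below y) d)).
  { apply filter_length_lt with x.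
    - intros z Hz%below_spec. apply below_spec.
      destruct Hz as [H1 H2], Hxy as [H3 H4]. split.
      + now apply (le_trans _ HL) with x.
      + intros ->. now apply H4, (le_antisym _ HL).
    - exact Hx.
    - apply Bool.not_true_is_false. intros H%below_spec. now destruct H.
    - now apply below_spec. }
  unfold rank at 1. destruct (excluded_middle_informative _); [contradiction|].
  unfold rank. destruct (excluded_middle_informative _); [|exact Hlt].
  pose proof (filter_length_le (below y) d). lia.
Qed.

Lemma rank_le x y : listed x -> listed y -> (rank x <= rank y <-> x ⊑ y).
Proof.
  intros Hx Hy. split; intros H.
  - apply NNPP. intros H'%(chain_nle C HC).
    apply rank_lt in H'; [lia | assumption..].
  - destruct (classic (x = y)) as [-> |]; [lia|].
    apply Nat.lt_le_incl, rank_lt; [assumption..|]. now split.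
Qed.

Lemma rank_inj x y : listed x -> listed y -> rank x = rank y -> x = y.
Proof.
  intros Hx Hy E. apply (le_antisym _ HL); apply rank_le; auto; lia.
Qed.

Lemma rank_zero : rank zero = 0.
Proof.
  unfold rank. destruct (excluded_middle_informative _); [contradiction|].
  destruct (filter (below zero) d) as [|y l] eqn:E; [reflexivity|].
  assert (Hy : In y (filter (below zero) d)) by (rewrite E; now left).
  apply filter_In in Hy. destruct Hy as [_ [H1 H2]%below_spec].
  destruct H2. apply (le_antisym _ HL); [exact H1 | apply (zero_le _ HL)].
Qed.

Lemma leb_rank x y : listed x -> listed y ->
  (x ⊑ y /\ (rank x <=? rank y) = true) \/
  (alg_lt C y x /\ (rank x <=? rank y) = false).
Proof.
  intros Hx Hy. destruct (classic (x ⊑ y)) as [H|H].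
  - left. split; [exact H|]. apply Nat.leb_le. now apply rank_le.
  - right. split; [now apply chain_nle|]. apply Nat.leb_gt.
    apply Nat.nle_gt. now rewrite rank_le.
Qed.

(** The listed elements form a subalgebra, since [x → y] is 1 or [y] and [x'] is
    0 or 1, and [to_fin] is a homomorphism on it. *)
Lemma eval_to_fin (v : nat -> C) a :
  (forall i, In i (vars a) -> listed (v i)) ->
  listed (eval v a) /\
  eval (fun i => to_fin (v i)) a = to_fin (eval v a).
Proof.
  induction a as [i | a IHa b IHb | a IHa b IHb | a IHa b IHb | a IHa | |];
    intros Hv; simpl in Hv;
    try (destruct IHa as [Ha Ea];
      [intros i Hi; apply Hv; auto using in_or_app|];
      simpl eval; rewrite Ea);
    try (destruct IHb as [Hb Eb];
      [intros i Hi; apply Hv; auto using in_or_app|];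
      rewrite Eb; simpl;
      destruct (leb_rank _ _ Ha Hb) as [[H E]|[H E]]; rewrite E).
  - split; [apply Hv; now left | reflexivity].
  - rewrite (le_join _ HL _ _ H). now split.
  - rewrite (joinC _ HL), (le_join _ HL _ _ (proj1 H)). now split.
  - rewrite H. now split.
  - rewrite (meetC _ HL), (proj1 H). now split.
  - rewrite (proj2 (chain_imp_one C HC _ _) H). split; [now right|].
    apply fin_eq. simpl. now rewrite rank_one.
  - rewrite (chain_imp_gt C HC _ _ H). now split.
  - simpl. destruct (classic (eval v a = one)) as [E|E].
    + rewrite E, rank_one, Nat.eqb_refl, (neg_one _ HD).
      split; [now left|]. apply fin_eq. simpl. now rewrite rank_zero.
    + rewrite (chain_neg C HC _ E). split; [now right|].
      destruct (Nat.eqb_spec (rank (eval v a)) (n - 1)) as [E'|_].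
      * destruct E.
        apply rank_inj; [exact Ha | now right | now rewrite rank_one].
      * apply fin_eq. simpl. now rewrite rank_one.
  - split; [now left|]. apply fin_eq. simpl. now rewrite rank_zero.
  - split; [now right|]. apply fin_eq. simpl. now rewrite rank_one.
Qed.

End Rank.

(** * Finitely many instances of the chain axiom *)

(** All lists of length [n] with members from [l]. *)
Fixpoint all_lists {T : Type} (l : list T) (n : nat) : list (list T) :=
  match n with
  | 0 => nil :: nil
  | S m => flat_map (fun x => map (cons x) (all_lists l m)) l
  end.

Lemma in_all_lists {T : Type} (l k : list T) :
  incl k l -> In k (all_lists l (length k)).
Proof.
  induction k as [|x k IH]; intros Hk; simpl; [now left|].
  apply in_flat_map. exists x. split; [apply Hk; now left|].
  apply in_map, IH. intros y Hy. apply Hk. now right.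
Qed.

Lemma incl_map_preimage {T U : Type} (f : T -> U) (l : list T) (k : list U) :
  incl k (map f l) -> exists k', incl k' l /\ map f k' = k.
Proof.
  induction k as [|y k IH]; intros Hk.
  - exists nil. split; [apply incl_nil_l | reflexivity].
  - destruct IH as (k' & Hk' & E); [intros z Hz; apply Hk; now right|].
    destruct (proj1 (in_map_iff f l y) (Hk y (or_introl eq_refl)))
      as (x & Ex & Hx).
    exists (x :: k'). split; [now apply incl_cons | simpl; congruence].
Qed.

(** The substitution sending the variables 1, ..., k to the members of a list
    [l] of length k; it is read only at these variables, the chain axiom being
    numbered from 1. *)
Definition list_subst (l : list formula) (j : nat) : formula :=
  nth (j - 1) l Bot.

(** The instances of the chain axiom whose substituted formulas are ⊥ or
    variables of [s] or [t]. *)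
Definition chain_instances (n : nat) (s t : formula) : list formula :=
  map (fun l => subst (list_subst l) (chain_axiom n))
    (all_lists (Bot :: map Var (vars s ++ vars t)) n).

(** If an equation valid in the [n]-element chain is tested at a valuation that
    satisfies the finitely many relevant instances of the chain axiom, it
    holds. *)
Lemma chain_instances_complete (C : algebra) (n : nat) s t (v : nat -> C) :
  DPCH_chain C -> 2 <= n ->
  (forall B, DPCH_chain B /\ has_cardinal B n -> satisfies B s t) ->
  (forall g, In g (chain_instances n s t) -> eval v g = one) ->
  eval v s = eval v t.
Proof.
  intros HC Hn Hst Hg.
  pose proof (sh_lattice C (dhmsh_sh C (dpch_dhmsh C (proj1 HC)))) as HL.
  destruct (classic (zero = one :> C)) as [E01|Hnt].
  { assert (Htriv : forall x : C, x = zero).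
    { intros x. apply (le_antisym _ HL); [|apply (zero_le _ HL)].
      rewrite E01. apply (le_one _ HL). }
    now rewrite (Htriv (eval v s)), (Htriv (eval v t)). }
  set (F := Bot :: map Var (vars s ++ vars t)).
  destruct (descending_enumeration C HC (map (eval v) F)) as (d & Hd & Ed).
  assert (Hlen : length d <= n - 1).
  { apply Nat.nlt_ge. intros Hlen.
    (* Formulas in [F] naming the first [n] elements of [d], in decreasing
       order, refute an instance of the chain axiom. *)
    destruct (incl_map_preimage (eval v) F (firstn n d)) as (l & Hl & El).
    { intros x Hx. apply Ed. rewrite <- (firstn_skipn n d).
      apply in_or_app. now left. }
    assert (Hll : length l = n).
    { rewrite <- (length_map (eval v)), El, length_firstn. lia. }
    assert (Hw : forall j, j < n -> eval v (list_subst l (S j)) = nth j d zero).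
    { intros j Hj. unfold list_subst. rewrite Nat.sub_succ, Nat.sub_0_r.
      change (@zero C) with (eval v Bot).
      rewrite <- (map_nth (eval v) l), El, nth_firstn.
      destruct (Nat.ltb_spec j n); [reflexivity | lia]. }
    assert (Hinst : eval v (subst (list_subst l) (chain_axiom n)) = one).
    { apply Hg. unfold chain_instances.
      apply (in_map (fun l => subst (list_subst l) (chain_axiom n))).
      rewrite <- Hll. now apply in_all_lists. }
    rewrite eval_subst, chain_axiom_one in Hinst by assumption.
    destruct Hinst as [([|j] & Hj & E)|([|j] & Hj & E)]; try lia.
    - rewrite Hw in E by lia.
      apply (proj1 (Ed (nth j d zero))); [|exact E]. apply nth_In. lia.
    - rewrite !Hw in E by lia. revert E. apply chain_nle; [exact HC|].
      apply (sorted_nth_succ C d j zero Hd). lia. }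
  assert (Hzero : In zero d) by (apply Ed; split; [now left | exact Hnt]).
  assert (Hv : forall i, In i (vars s ++ vars t) -> listed C d (v i)).
  { intros i Hi. destruct (classic (v i = one)); [now right|]. left.
    apply Ed. split; [|assumption]. right. rewrite map_map. simpl.
    now apply (in_map v). }
  destruct (eval_to_fin C n d HC Hn Hnt Hzero Hlen v s) as [Hs Es].
  { intros i Hi. apply Hv, in_or_app. now left. }
  destruct (eval_to_fin C n d HC Hn Hnt Hzero Hlen v t) as [Ht Et].
  { intros i Hi. apply Hv, in_or_app. now right. }
  apply (rank_inj C n d HC Hn Hlen); [exact Hs | exact Ht |].
  change (proj1_sig (to_fin C n d Hn Hlen (eval v s)) =
          proj1_sig (to_fin C n d Hn Hlen (eval v t))).
  rewrite <- Es, <- Et. f_equal. apply Hst. split.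
  - apply fin_chain_DPCH_chain.
  - apply fin_chain_cardinal.
Qed.

(** The conjunction of the formulas ∼∼g for [g] in [l]. *)
Definition double_neg_conj (l : list formula) : formula :=
  fold_right (fun g => And (Neg (Neg g))) Top l.

Lemma double_neg_conj_one (A : algebra) (HD : DHMSH A) (v : nat -> A) l :
  (forall g, In g l -> eval v g = one) -> eval v (double_neg_conj l) = one.
Proof.
  intros H. induction l as [|g l IH]; [reflexivity|]. simpl.
  rewrite H by now left. rewrite IH by (intros; apply H; now right).
  rewrite (neg_one _ HD), (neg_zero _ HD).
  apply (meet_one _ (sh_lattice _ (dhmsh_sh _ HD))).
Qed.

(** In a chain, [∼∼g] takes the value 1 when [g] does and 0 otherwise. *)
Lemma double_neg_conj_chain (C : algebra) (HC : DPCH_chain C) (v : nat -> C) l :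
  (forall g, In g l -> eval v g = one) \/ eval v (double_neg_conj l) = zero.
Proof.
  pose proof (sh_lattice C (dhmsh_sh C (dpch_dhmsh C (proj1 HC)))) as HL.
  induction l as [|g l IH]; [left; intros ? []|]. simpl.
  destruct (classic (eval v g = one)) as [Hg|Hg].
  - destruct IH as [IH|IH].
    + left. intros h [<- | Hh]; auto.
    + right. rewrite IH, (meetC _ HL). apply (zero_le _ HL).
  - right. rewrite (chain_neg_neg C HC _ Hg). apply (zero_le _ HL).
Qed.

Lemma DPCH_chain_DHMSH B : DPCH_chain B -> DHMSH B.
Proof. intros HB. apply HB. Qed.

(** * The axiomatisation *)

Lemma DPCG_n_chain_axiom n A : 2 <= n ->
  (DPCG_ n A <-> DPCG A /\ satisfies A (chain_axiom n) Top).
Proof.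
  intros Hn. split.
  - intros HA. split.
    + revert HA. apply variety_generated_by_mono. now intros B [HB _].
    + apply (proj1 (variety_generated_by_equations _ A) HA).
      intros B [HB Hcard]. now apply chain_axiom_valid.
  - intros [HA Hax]. apply variety_generated_by_equations. intros s t Hst v.
    assert (HD : DHMSH A)
      by exact (variety_generated_by_DHMSH _ A DPCH_chain_DHMSH HA).
    pose proof (sh_lattice A (dhmsh_sh A HD)) as HL.
    set (c := double_neg_conj (chain_instances n s t)).
    (* [c] is 0 or makes [s] and [t] equal, in every chain. *)
    assert (E : satisfies A (And c s) (And c t)).
    { apply (proj1 (variety_generated_by_equations _ A) HA).
      intros C HC w. simpl.
      destruct (double_neg_conj_chain C HC w (chain_instances n s t)) as [H|H].
      - now rewrite (chain_instances_complete C n s t w HC Hn Hst H).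
      - unfold c. rewrite H.
        pose proof (sh_lattice C (dhmsh_sh C (DPCH_chain_DHMSH C HC))) as HLC.
        now rewrite !(zero_le _ HLC). }
    assert (Hc : eval v c = one).
    { apply double_neg_conj_one; [exact HD|]. intros g Hg.
      apply in_map_iff in Hg. destruct Hg as (l & <- & _).
      rewrite eval_subst. apply Hax. }
    specialize (E v). simpl in E. rewrite Hc in E.
    now rewrite !(meetC _ HL one), !(meet_one _ HL) in E.
Qed.

Theorem corollary9p8 :
  forall n : nat, 2 <= n ->
  exists LG Ln : logic,
    the_logic_of DPCG LG /\
    the_logic_of (DPCG_ n) Ln /\
    axiomatized_relative_to LG Ln (chain_axiom n).
Proof.
  intros n Hn.
  set (Kn := fun A => DPCH_chain A /\ has_cardinal A n).
  assert (HG : corresponds DPCG (logic_of_class DPCH_chain))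
    by exact (logic_of_class_corresponds _ DPCH_chain_DHMSH).
  assert (HN : corresponds (DPCG_ n) (logic_of_class Kn)).
  { apply logic_of_class_corresponds. now intros B [HB%DPCH_chain_DHMSH _]. }
  exists (logic_of_class DPCH_chain), (logic_of_class Kn).
  split; [now apply the_logic_of_intro|].
  split; [now apply the_logic_of_intro|].
  intros Ax HAx.
  apply (corresponds_unique (DPCG_ n)); [|exact HN].
  split.
  { exists (fun a => Ax a \/ a = chain_axiom n). intros Gamma a. reflexivity. }
  intros A. rewrite DPCG_n_chain_axiom by exact Hn.
  destruct HG as [_ HG]. rewrite (HG A). split.
  - intros [[HD HA] Hc]. split; [exact HD|]. intros d Hd v.
    apply (extension_sound _ _ A v d HD) with (3 := Hd); [|intros ? []].
    intros e [He | ->]; [|exact Hc]. apply HA, HAx.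
    now apply extension_axiom.
  - intros [HD HA]. split; [split; [exact HD|]|].
    + intros d Hd. apply HA. apply HAx in Hd. revert Hd.
      apply extension_mono; auto.
    + apply HA. apply extension_axiom. now right.
Qed.
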